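(* For all positive integers $a,c$, $$\Gamma(a,ca+1)=\begin{cases}1,&\text{if } a\text{ is even and } c\text{ is odd},\\ 0,&\text{otherwise.}\end{cases}$$
   Context: For coprime positive integers $a,b$, it is known that exactly one of the two equations $ax+by=\frac{(a-1)(b-1)}{2}$ and $1+ax+by=\frac{(a-1)(b-1)}{2}$ has a solution in nonnegative integers $x,y$. Define $\Gamma(a,b)=0$ if the first equation has such a solution, and $\Gamma(a,b)=1$ if the second does. *)

(* Defs.v *)
From mathcomp Require Import all_boot.
From mathcomp Require Import boolp zify.

Set Implicit Arguments.
Unset Strict Implicit.
Unset Printing Implicit Defensive.

(* For coprime positive a and b, at least one of a, b is odd, so the division
   by 2 is exact, and the subtractions are not truncated. *)
Definition Gamma_target (a b : nat) : nat := ((a - 1) * (b - 1)) %/ 2.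

Definition Gamma_eqn0 (a b : nat) : Prop :=
  exists x y : nat, a * x + b * y = Gamma_target a b.

Definition Gamma_eqn1 (a b : nat) : Prop :=
  exists x y : nat, 1 + a * x + b * y = Gamma_target a b.

(* The value 2 is junk, never attained on coprime positive arguments: see
   Gamma_exclusive and GammaP below. *)
Definition Gamma (a b : nat) : nat :=
  if `[< Gamma_eqn0 a b >] then 0
  else if `[< Gamma_eqn1 a b >] then 1
  else 2.

Lemma Gamma_target2 a b : 0 < a -> 0 < b -> coprime a b ->
  Gamma_target a b * 2 + a + b = a * b + 1.
Proof.
move=> a0 b0 cab.
have dv : 2 %| (a - 1) * (b - 1).
  rewrite dvdn2 oddM negb_and !oddB // !addbT !negbK.
  apply/negPn/negP; rewrite negb_or => /andP[ea eb].
  have : 2 %| gcdn a b by rewrite dvdn_gcd !dvdn2 ea.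
  by rewrite (eqP cab).
by rewrite /Gamma_target divnK //; nia.
Qed.

Lemma Gamma_exclusive a b : 0 < a -> 0 < b -> coprime a b ->
  (Gamma_eqn0 a b /\ ~ Gamma_eqn1 a b) \/ (~ Gamma_eqn0 a b /\ Gamma_eqn1 a b).
Proof.
move=> a0 b0 cab; have := Gamma_target2 a0 b0 cab.
rewrite /Gamma_eqn0 /Gamma_eqn1; move: (Gamma_target a b) => n nE.
have excl : (exists x y, a * x + b * y = n) ->
    ~ (exists x y, 1 + a * x + b * y = n).
  move=> [x [y E0]] [x' [y' E1]].
  have E : a * (x + x' + 1) + b * (y + y' + 1) = a * b by nia.
  have bx : b %| x + x' + 1.
    rewrite -(@Gauss_dvdr b a) 1?coprime_sym //.
    by rewrite -(@dvdn_addl (b * (y + y' + 1))) ?dvdn_mulr // E dvdn_mull.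
  have le : b <= x + x' + 1 by apply: dvdn_leq bx; rewrite addn1.
  by nia.
have [u v uE _] := egcdnP b a0; rewrite (eqP cab) in uE.
pose x := (u * n) %% b.
have xb : x < b by rewrite ltn_mod.
have xE : a * x = n %[mod b].
  rewrite /x modnMmr mulnA (mulnC a) uE mulnDl mul1n mulnAC modnMDl //.
have [le|lt] := leqP (a * x) n.
  have dv : b %| n - a * x by rewrite -eqn_mod_dvd // xE.
  left; have S : exists x y, a * x + b * y = n.
    exists x, ((n - a * x) %/ b).
    by rewrite (mulnC b) divnK // subnKC.
  by split => //; exact: excl.
have dv : b %| a * x - n by rewrite -eqn_mod_dvd ?xE // ltnW.
case/dvdnP: dv => k kE.
have S : exists x y, 1 + a * x + b * y = n.
  have k0 : 0 < k by case: k kE => [|//]; lia.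
  exists (b - 1 - x), (k - 1).
  have bE : a * b = a * x + a + a * (b - 1 - x).
    by rewrite -mulnSr -mulnDr; congr muln; clearbody x; lia.
  have kbE : k * b = b * (k - 1) + b.
    by rewrite -mulnSr mulnC; congr muln; lia.
  by clearbody x; lia.
by right; split => // S0; exact: excl S0 S.
Qed.

Lemma GammaP a b : 0 < a -> 0 < b -> coprime a b ->
  (Gamma a b = 0 <-> Gamma_eqn0 a b) /\ (Gamma a b = 1 <-> Gamma_eqn1 a b).
Proof.
move=> a0 b0 cab; rewrite /Gamma.
by case: (Gamma_exclusive a0 b0 cab) => -[h0 h1];
  case: asboolP => // _; rewrite ?(asboolT h1).
Qed.

(* Main.v *)
Require Import Defs.
From mathcomp Require Import all_boot.
From mathcomp Require Import zify.

(** Write n = (a - 1) c a / 2 for the right-hand side of both equations with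
    b = c a + 1. If (a - 1) c is even, then n is a multiple of a, and the first
    equation is solved with y = 0. Otherwise a = 2 k and c = 2 d + 1, and the
    second equation must satisfy 1 + y = n = k modulo a; the choice y = k - 1
    then leaves x = d. Since a and b are coprime, [GammaP] turns a solution of
    either equation into the value of Gamma. *)

Lemma coprime_mulnD1 (a c : nat) : coprime a (c * a + 1).
Proof. by rewrite /coprime gcdnMDl gcdn1. Qed.

Lemma Gamma_target_mulnD1 (a c : nat) :
  Gamma_target a (c * a + 1) = ((a - 1) * (c * a)) %/ 2.
Proof. by rewrite /Gamma_target addnK. Qed.

Lemma Gamma_eqn0_mulnD1 (a c : nat) :
  ~~ odd ((a - 1) * c) -> Gamma_eqn0 a (c * a + 1).
Proof.
rewrite -dvdn2 => /dvdnP[q qE]; exists q, 0.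
by rewrite Gamma_target_mulnD1 mulnA qE mulnAC mulnK // muln0 addn0 mulnC.
Qed.

Lemma Gamma_eqn1_mulnD1 (a c : nat) :
  0 < a -> ~~ odd a -> odd c -> Gamma_eqn1 a (c * a + 1).
Proof.
move=> a0 ea oc; exists c./2, (a./2 - 1).
rewrite Gamma_target_mulnD1.
have := odd_double_half a; have := odd_double_half c.
rewrite oc (negbTE ea) add0n add1n.
move: a./2 c./2 => k d cE aE; subst a c.
have k0 : 0 < k by lia.
suff -> : (k.*2 - 1) * (d.*2.+1 * k.*2) =
          (1 + k.*2 * d + (d.*2.+1 * k.*2 + 1) * (k - 1)) * 2 by rewrite mulnK.
case: k k0 {a0 ea oc} => // k _.
by rewrite subn1 subn1 /=; nia.
Qed.

Theorem theorem4p4 (a c : nat) (ha : 0 < a) (hc : 0 < c) :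
  Gamma a (c * a + 1) = if ~~ odd a && odd c then 1 else 0.
Proof.
have b0 : 0 < c * a + 1 by rewrite addn1.
have [G0 G1] := GammaP ha b0 (coprime_mulnD1 a c).
case: ifP => [/andP[ea oc]|par]; first exact/G1/Gamma_eqn1_mulnD1.
apply/G0/Gamma_eqn0_mulnD1.
by rewrite oddM oddB // addbT par.
Qed.
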